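(* Let $N\ge 1$, let $B_I\in\mathbb{R}^{N\times N}$ be a nonsingular matrix, let $W_I\in\mathbb{R}^N$, and let $x\in\mathbb{R}^N$ be the nonzero vector satisfying $B_I\cdot x=W_I$. Let $E_B\in\mathbb{R}^{N\times N}$ and $E_W\in\mathbb{R}^N$ be perturbations, and put $\bar B_I=B_I+E_B$ and $\bar W_I=W_I+E_W$. Suppose that $$\|B_I^{-1}\cdot E_B\|<1 .$$ Then the noisy linear system $\bar B_I\cdot x^*=\bar W_I$ determines $x^*$ (that is, it has exactly one solution $x^*\in\mathbb{R}^N$), and the relative error satisfies $$\frac{\|x^*-x\|}{\|x\|}\le\frac{\kappa(B_I)}{1-\|B_I^{-1}\cdot E_B\|}\left(\frac{\|E_B\|}{\|B_I\|}+\frac{\|E_W\|}{\|W_I\|}\right).$$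
   Context: $\|\cdot\|$ denotes a fixed norm on $\mathbb{R}^N$ and, for matrices, the operator norm it induces. $\kappa(B_I):=\|B_I\|\cdot\|B_I^{-1}\|$ is the condition number of $B_I$. Origin of the system: in a neural network with loss $\mathcal{L}$, a fully-connected layer with input $o\in\mathbb{R}^N$, weights $w\in\mathbb{R}^{M\times N}$ and bias $b\in\mathbb{R}^M$ satisfies $\partial\mathcal{L}/\partial w_{mn}=(\partial\mathcal{L}/\partial b_m)\,o_n$ for all $m,n$. This is a linear system in the unknown input whose coefficients are bias gradients and whose right-hand side consists of weight gradients. An index set $I$ of equations is chosen so that the resulting system $B_I\cdot x=W_I$ is well-posed, where $B_I$ is built from the bias gradients, $W_I$ from the weight gradients, and $x$ is the input to be reconstructed. $\bar B_I,\bar W_I$ are the observed (perturbed) versions of $B_I,W_I$. The theorem concerns only this linear system. *)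

(* Defs.v *)
From mathcomp Require Import all_boot all_order all_algebra.
From mathcomp Require Import boolp classical_sets reals.

Set Implicit Arguments.
Unset Strict Implicit.
Unset Printing Implicit Defensive.

Import Order.TTheory GRing.Theory Num.Theory.

Local Open Scope classical_set_scope.
Local Open Scope ring_scope.

(* The fields are those of the factory Lmodule_isNormed of normed_module.v.
   The norm is a predicate on functions rather than a structure on 'cV[R]_N
   because that type already carries MathComp-Analysis's canonical max norm.
   Nonnegativity follows from the triangle inequality and homogeneity. *)
Record is_norm (R : realType) (N : nat) (nu : 'cV[R]_N -> R) : Prop := IsNorm {
  norm_triangle : forall u v, nu (u + v) <= nu u + nu v;
  norm_scale : forall (a : R) u, nu (a *: u) = `|a| * nu u;
  norm_definite : forall u, nu u = 0 -> u = 0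
}.

(* When nu is a norm and 0 < N, this set is nonempty and (by finite dimension)
   bounded above, so the junk value of [sup] is not used. *)
Definition op_norm (R : realType) (N : nat) (nu : 'cV[R]_N -> R)
    (A : 'M[R]_N) : R :=
  sup [set nu (A *m u) / nu u | u in [set u : 'cV[R]_N | u != 0]].

Definition cond_num (R : realType) (N : nat) (nu : 'cV[R]_N -> R)
    (A : 'M[R]_N) : R :=
  op_norm nu A * op_norm nu (invmx A).

(* Main.v *)
(* The error d = x* - x satisfies d = B^-1 (E_W - E_B x) - B^-1 E_B d. Taking
   norms and absorbing the last term on the left gives
   (1 - |B^-1 E_B|) |d| <= |B^-1| (|E_W| + |E_B| |x|); divide by |x| and use
   |W| <= |B| |x|. Solvability holds because (1 + B^-1 E_B) v = 0 forces
   |v| <= |B^-1 E_B| |v|. All of this needs |A u| <= |A| |u|, i.e. that the set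
   defining the operator norm is bounded above, which follows from the
   equivalence of an arbitrary norm with the max norm. *)
Require Import Defs.
From mathcomp Require Import all_boot all_order all_algebra.
From mathcomp Require Import boolp classical_sets reals.
From mathcomp Require Import topology normedtype derive ring lra.

Set Implicit Arguments.
Unset Strict Implicit.
Unset Printing Implicit Defensive.

Import Order.TTheory GRing.Theory Num.Theory.
Import numFieldNormedType.Exports.

Local Open Scope ring_scope.

Lemma row_entry_le_norm (R : realType) (n : nat) (v : 'rV[R]_n) (i : 'I_n) :
  `|v ord0 i| <= `|v|.
Proof.
rewrite [X in _ <= X]/Num.norm /= mx_normrE.
exact: (le_bigmax _ (fun ij : 'I_1 * 'I_n => `|v ij.1 ij.2|) (ord0, i)).
Qed.

Section Seminorm.
Variables (R : realType) (N : nat) (p : 'cV[R]_N -> R).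
Hypothesis p_triangle : forall u v, p (u + v) <= p u + p v.
Hypothesis p_scale : forall (a : R) u, p (a *: u) = `|a| * p u.

Lemma seminorm0 : p 0 = 0.
Proof. by rewrite -(scale0r 0) p_scale normr0 mul0r. Qed.

Lemma seminormN u : p (- u) = p u.
Proof. by rewrite -scaleN1r p_scale normrN normr1 mul1r. Qed.

Lemma seminorm_ge0 u : 0 <= p u.
Proof. by have := p_triangle u (- u); rewrite subrr seminorm0 seminormN; lra. Qed.

Lemma seminorm_leB u v : p (u - v) <= p u + p v.
Proof. by rewrite (le_trans (p_triangle _ _))// seminormN. Qed.

Lemma seminorm_sum (I : finType) (F : I -> 'cV[R]_N) :
  p (\sum_i F i) <= \sum_i p (F i).
Proof.
elim/big_ind2: _ => [|u a v b ua vb|//]; first by rewrite seminorm0.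
exact: le_trans (p_triangle _ _) (lerD ua vb).
Qed.

Lemma seminorm_dist u v : `|p u - p v| <= p (u - v).
Proof.
have H1 := p_triangle (u - v) v; have H2 := p_triangle (v - u) u.
rewrite !subrK in H1 H2; rewrite -opprB seminormN in H2.
by rewrite ler_norml; apply/andP; split; lra.
Qed.

(** Expand [u] in the standard basis and bound every coordinate by the max norm. The sum of the
    [p]-values of the basis vectors may vanish, so 1 is added to keep the constant positive. *)
Lemma seminorm_le_maxnorm : exists2 K, 0 < K & forall u, p u <= K * `|u^T|.
Proof.
pose K := \sum_(i < N) p (delta_mx i ord0).
have K0 : 0 <= K by apply: sumr_ge0 => i _; exact: seminorm_ge0.
exists (K + 1) => [|u]; first by lra.
apply: (@le_trans _ _ (K * `|u^T|)); last by rewrite ler_wpM2r//; lra.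
have -> : p u = p (\sum_i (u i ord0 *: delta_mx i ord0)).
  by rewrite {1}(matrix_sum_delta u); under eq_bigr do rewrite big_ord1.
apply: le_trans (seminorm_sum _) _; rewrite mulr_suml ler_sum// => i _.
rewrite p_scale mulrC ler_wpM2l ?seminorm_ge0//.
by have := row_entry_le_norm u^T i; rewrite mxE.
Qed.

(** By the reverse triangle inequality [p] is [K]-Lipschitz for the max norm. The domain is
    transposed because [EVT_min_rV], used below, works on row vectors. *)
Lemma seminorm_continuous : continuous (fun v : 'rV[R]_N => p v^T).
Proof.
have [K K0 pK] := seminorm_le_maxnorm.
move=> v; apply/(@cvgrPdist_lt _ _ _ (nbhs v)) => e e0.
apply/nbhs_ballP; exists (e / K) => /=; first exact: divr_gt0.
move=> w; rewrite mx_norm_ball /ball_ /= => vw.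
rewrite (le_lt_trans (seminorm_dist _ _))// -linearB (le_lt_trans (pK _))//.
by rewrite trmxK mulrC -ltr_pdivlMr.
Qed.

(* [c] is the minimum of [p] on the unit sphere of the max norm, which is
   compact. *)
Lemma definite_seminorm_ge_maxnorm : (forall u, p u = 0 -> u = 0) ->
  exists2 c, 0 < c & forall u, c * `|u^T| <= p u.
Proof.
move=> p0.
pose S : set 'rV[R]_N := [set v | `|v| = 1]%classic.
have normS (u : 'cV[R]_N) : u != 0 -> S (`|u^T|^-1 *: u^T).
  move=> u0; rewrite /S /= normrZ normfV normr_id mulVf// normr_eq0.
  by apply: contra u0 => /eqP H; rewrite -(trmxK u) H trmx0.
(* The sphere is empty exactly when [N] is 0; then 0 is the only vector and any positive constant
   serves. *)
have [[v0 Sv0]|Sempty] := pselect (exists v, S v); last first.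
  exists 1 => // u; have [->|/normS Su] := eqVneq u 0.
    by rewrite trmx0 normr0 mulr0 seminorm0.
  by case: Sempty; exists (`|u^T|^-1 *: u^T).
have cS : compact S.
  apply: bounded_closed_compact.
    by exists 1; split => // M M1 v /= ->; exact: ltW.
  apply: (@closed_comp _ _ (fun v : 'rV[R]_N => `|v|) [set 1]%classic).
    by move=> v _; exact: norm_continuous.
  exact: closed_eq.
have [|w wS wmin] := @EVT_min_rV R N (fun v => p v^T) S (ex_intro _ v0 Sv0) cS.
  exact/continuous_subspaceT/seminorm_continuous.
have {}wS : S w by rewrite inE in wS.
exists (p w^T) => [|u].
  rewrite lt_neqAle seminorm_ge0 andbT eq_sym; apply/eqP => /p0 H.
  move: wS; rewrite /S /= -(trmxK w) H trmx0 normr0 => /eqP.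
  by rewrite eq_sym oner_eq0.
have [->|u0] := eqVneq u 0; first by rewrite trmx0 normr0 mulr0 seminorm0.
have un0 : 0 < `|u^T|.
  by rewrite normr_gt0; apply: contra u0 => /eqP H; rewrite -(trmxK u) H trmx0.
have := wmin _ (mem_set (normS _ u0)).
rewrite linearZ /= trmxK p_scale normfV normr_id.
by rewrite mulrC ler_pdivlMr.
Qed.

End Seminorm.

Section OperatorNorm.
Variables (R : realType) (N : nat) (nu : 'cV[R]_N -> R).
Hypothesis hnu : is_norm nu.

Lemma norm_gt0 u : u != 0 -> 0 < nu u.
Proof.
case: hnu => tri sc def u0; rewrite lt_neqAle (seminorm_ge0 tri sc) andbT eq_sym.
by apply: contra u0 => /eqP/def ->.
Qed.

Lemma op_norm_bound (A : 'M[R]_N) u : nu (A *m u) <= op_norm nu A * nu u.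
Proof.
case: (hnu) => tri sc def.
have [->|u0] := eqVneq u 0; first by rewrite mulmx0 (seminorm0 sc) mulr0.
rewrite -ler_pdivrMr ?norm_gt0//.
(* The map sending [v] to [nu (A *m v)] is again a seminorm, definite only if [A] is injective. *)
have [K K0 HK] : exists2 K, 0 < K & forall v, nu (A *m v) <= K * `|v^T|.
  apply: (@seminorm_le_maxnorm R N (fun v => nu (A *m v))) => [v w|a v].
    by rewrite mulmxDr.
  by rewrite -scalemxAr sc.
have [c c0 Hc] := definite_seminorm_ge_maxnorm tri sc def.
apply: ub_le_sup; last by exists u.
(* Combine [nu (A *m v) <= K * |v|] with [c * |v| <= nu v], where [|v|] is the max norm. *)
exists (K / c) => _ [v /= v0 <-]; rewrite ler_pdivrMr ?norm_gt0//.
apply: le_trans (HK v) _; rewrite -mulrA ler_pM2l//.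
by rewrite mulrC ler_pdivlMr// mulrC.
Qed.

Lemma op_norm_ge0 (A : 'M[R]_N) (u : 'cV[R]_N) : u != 0 -> 0 <= op_norm nu A.
Proof.
case: (hnu) => tri sc _ /norm_gt0 u0; rewrite -(pmulr_lge0 _ u0).
exact: le_trans (seminorm_ge0 tri sc _) (op_norm_bound A u).
Qed.

Lemma unitmx_perturb (B E : 'M[R]_N) : B \in unitmx ->
  op_norm nu (invmx B *m E) < 1 -> B + E \in unitmx.
Proof.
(* [det0P] yields a row vector in a left kernel, so it is applied to the transpose to reach a column
   vector killed by [B + E]. *)
case: (hnu) => tri sc _ uB F1; rewrite -unitmx_tr unitmxE unitfE.
apply/det0P => -[v v0 /(congr1 trmx)].
rewrite trmx_mul trmxK trmx0 mulmxDl => /(congr1 (mulmx (invmx B))).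
rewrite mulmxDr mulKmx// mulmx0 mulmxA => /eqP; rewrite addr_eq0 => /eqP vE.
have vt0 : v^T != 0 by apply: contra v0 => /eqP H; rewrite -(trmxK v) H trmx0.
have := op_norm_bound (invmx B *m E) v^T; rewrite -(seminormN sc) -vE.
by rewrite leNgt gtr_pMl ?F1 ?norm_gt0.
Qed.

End OperatorNorm.

Theorem theorem2p2 (R : realType) (N : nat) (hN : (1 <= N)%N)
    (nu : 'cV[R]_N -> R) (hnu : is_norm nu)
    (B EB : 'M[R]_N) (W EW x : 'cV[R]_N)
    (hB : B \in unitmx) (hx0 : x != 0) (hx : B *m x = W)
    (hE : op_norm nu (invmx B *m EB) < 1) :
  (exists! xs : 'cV[R]_N, (B + EB) *m xs = W + EW) /\
  (forall xs : 'cV[R]_N, (B + EB) *m xs = W + EW ->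
     nu (xs - x) / nu x <=
       cond_num nu B / (1 - op_norm nu (invmx B *m EB)) *
       (op_norm nu EB / op_norm nu B + nu EW / nu W)).
Proof.
case: (hnu) => tri sc _.
have uBE := unitmx_perturb hnu hB hE.
split.
  exists (invmx (B + EB) *m (W + EW)); split; first exact: mulKVmx.
  by move=> xs <-; exact: mulKmx.
move=> xs hxs; set d := xs - x.
have dE : d = invmx B *m (EW - EB *m x) - invmx B *m EB *m d.
  (* Subtracting [(B + EB) *m x] from the perturbed system shows that the residual is
     [(B + EB) *m d]. *)
  have -> : EW - EB *m x = B *m d + EB *m d.
    rewrite -mulmxDl mulmxBr hxs mulmxDl hx.
    by rewrite opprD addrACA subrr add0r.
  by rewrite mulmxDr mulKmx// mulmxA addrK.
have x0 := norm_gt0 hnu hx0.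
have W0 : 0 < nu W.
  apply: (norm_gt0 hnu); apply: contra hx0 => /eqP W0.
  by rewrite -(mulKmx hB x) hx W0 mulmx0.
(* This bound on [nu W] serves twice: it makes [op_norm nu B] positive here, and it supplies the
   last inequality of the proof. *)
have Bx := op_norm_bound hnu B x; rewrite hx in Bx.
have B0 : 0 < op_norm nu B by rewrite -(pmulr_lgt0 _ x0); exact: lt_le_trans Bx.
have Bi0 := op_norm_ge0 hnu (invmx B) hx0.
have d_le : nu d * (1 - op_norm nu (invmx B *m EB)) <=
    op_norm nu (invmx B) * (nu EW + op_norm nu EB * nu x).
  have res_le : nu (EW - EB *m x) <= nu EW + op_norm nu EB * nu x.
    by rewrite (le_trans (seminorm_leB tri sc _ _))// lerD2l op_norm_bound.
  have := op_norm_bound hnu (invmx B) (EW - EB *m x).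
  have := ler_wpM2l Bi0 res_le.
  have := op_norm_bound hnu (invmx B *m EB) d.
  have := seminorm_leB tri sc (invmx B *m (EW - EB *m x)) (invmx B *m EB *m d).
  by rewrite -dE; lra.
have F1 : 0 < 1 - op_norm nu (invmx B *m EB) by rewrite subr_gt0.
rewrite ler_pdivrMr// /cond_num mulrAC -mulrA mulrAC ler_pdivlMr//.
apply: le_trans d_le _.
rewrite (mulrC (op_norm nu B)) -!mulrA ler_wpM2l//.
(* In this form the [EB] terms of both sides coincide, and [nu EW] carries the factor
   [|B| |x| / |W|], which is at least 1. *)
have -> : op_norm nu B * (nu x * (op_norm nu EB / op_norm nu B + nu EW / nu W))
    = nu EW * (op_norm nu B * nu x / nu W) + op_norm nu EB * nu x.
  by field; rewrite !gt_eqF.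
by rewrite lerD2r ler_peMr ?(seminorm_ge0 tri sc)// ler_pdivlMr// mul1r.
Qed.
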